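(* Let $G$ be a finitely presented group, and let $F$ be a field. Then $G$ is rank-stable over $F$ if and only if its group algebra $F[G]$ is rank-stable.
   Context: Algebras are associative and unital over a field $F$; $F\langle x_1,\dots,x_d\rangle$ denotes the free associative unital algebra (non-commutative polynomials). For $A\in M_n(F)$ let $\operatorname{rank}(A)=\dim_F\operatorname{Im}A$ and let $\operatorname{rk}(A)=\frac1n\operatorname{rank}(A)$ (normalized rank). For $A\in M_n(F)$, $\widehat{A}$ is the finitely supported $\mathbb{N}\times\mathbb{N}$ matrix that agrees with $A$ in entries $(i,j)$ with $1\le i,j\le n$ and is zero elsewhere. When matrices in $M_n(F)$ are substituted into a non-commutative polynomial, constant terms are interpreted as scalar $n\times n$ matrices. A finitely presented algebra $F\langle x_1,\dots,x_d\rangle/\langle P_1,\dots,P_r\rangle$ is rank-stable if for every $\varepsilon>0$ there exists $\delta>0$ such that for every $n\ge 1$ and every tuple $A_1,\dots,A_d\in M_n(F)$ with $\operatorname{rk}P_i(A_1,\dots,A_d)<\delta$ for all $1\le i\le r$, there exist $n'\ge 1$ and $B_1,\dots,B_d\in M_{n'}(F)$ with $P_i(B_1,\dots,B_d)=0$ for all $1\le i\le r$ and $\operatorname{rank}(\widehat{A_i}-\widehat{B_i})<\varepsilon n$ for all $1\le i\le d$. (This property does not depend on the chosen finite presentation of the algebra.) A finitely presented group $G=\langle x_1,\dots,x_d\mid P_1,\dots,P_r\rangle$ (with $P_1,\dots,P_r$ words in the free group on $x_1,\dots,x_d$) is rank-stable over $F$ if for every $\varepsilon>0$ there exists $\delta>0$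 such that for every $n\ge1$ and all $A_1,\dots,A_d\in GL_n(F)$ with $\operatorname{rk}(P_j(A_1,\dots,A_d)-\mathrm{Id}_n)<\delta$ for all $1\le j\le r$, there exist $n'\ge 1$ and $B_1,\dots,B_d\in GL_{n'}(F)$ such that $\operatorname{rank}(\widehat{A_i}-\widehat{B_i})<\varepsilon n$ for all $1\le i\le d$ and $P_j(B_1,\dots,B_d)=\mathrm{Id}_{n'}$ for all $1\le j\le r$. *)

(* Defs.v *)
From HB Require Import structures.
From mathcomp Require Import all_boot all_order all_algebra.
From mathcomp Require Import finmap reals.
From mathcomp.multinomials Require Import monalg.

Set Implicit Arguments.
Unset Strict Implicit.
Unset Printing Implicit Defensive.

Import Order.TTheory GRing.Theory Num.Theory.

Local Open Scope fset_scope.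
Local Open Scope ring_scope.

(* The ring structure of {malg F[K]} in monalg requires K to have no
   nontrivial units, which excludes groups: the convolution product is
   therefore defined here, on an alias of {malg F[G]}. *)
Definition group_algebra (F : fieldType) (G : groupType) : Type := {malg F[G]}.

HB.instance Definition _ (F : fieldType) (G : groupType) :=
  GRing.Lmodule.copy (group_algebra F G) {malg F[G]}.

Section GroupAlgebra.
Variables (F : fieldType) (G : groupType).

Implicit Types (g : {malg F[G]}) (k : G) (c : F).

Definition galg1 : {malg F[G]} := mkmalgU 1%g 1.

Definition galg_mul g1 g2 : {malg F[G]} :=
  \sum_(k1 <- msupp g1) \sum_(k2 <- msupp g2)
    mkmalgU (k1 * k2)%g (g1@_k1 * g2@_k2).

Lemma galg_mulw (d1 d2 : {fset G}) g1 g2 :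
  msupp g1 `<=` d1 -> msupp g2 `<=` d2 ->
  galg_mul g1 g2 =
    \sum_(k1 <- d1) \sum_(k2 <- d2) mkmalgU (k1 * k2)%g (g1@_k1 * g2@_k2).
Proof.
move=> le_d1 le_d2; rewrite /galg_mul (big_fset_incl _ le_d1) /=.
  apply/eq_bigr=> k1 _; apply/big_fset_incl => // k _ /mcoeff_outdom ->.
  by rewrite mulr0 monalgU0.
move=> k _ /mcoeff_outdom g1k.
by rewrite big1 => // k' _; rewrite g1k mul0r monalgU0.
Qed.

Lemma galg_mulDl : left_distributive galg_mul +%R.
Proof.
move=> g1 g2 g; pose d := msupp g1 `|` msupp g2.
rewrite (@galg_mulw d (msupp g) (g1 + g2)) ?msuppD_le //.
rewrite (@galg_mulw d (msupp g) g1) ?fsubsetUl //.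
rewrite (@galg_mulw d (msupp g) g2) ?fsubsetUr //.
rewrite -big_split /=; apply/eq_bigr=> k1 _.
rewrite -big_split /=; apply/eq_bigr=> k2 _.
by rewrite mcoeffD mulrDl monalgUD.
Qed.

Lemma galg_mulDr : right_distributive galg_mul +%R.
Proof.
move=> g g1 g2; pose d := msupp g1 `|` msupp g2.
rewrite (@galg_mulw (msupp g) d g (g1 + g2)) ?msuppD_le //.
rewrite (@galg_mulw (msupp g) d g g1) ?fsubsetUl //.
rewrite (@galg_mulw (msupp g) d g g2) ?fsubsetUr //.
rewrite -big_split /=; apply/eq_bigr=> k1 _.
rewrite -big_split /=; apply/eq_bigr=> k2 _.
by rewrite mcoeffD mulrDr monalgUD.
Qed.

Lemma galg_mul0g : left_zero 0 galg_mul.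
Proof. by move=> g; rewrite /galg_mul msupp0 big_seq_fset0. Qed.

Lemma galg_mulg0 : right_zero 0 galg_mul.
Proof.
by move=> g; rewrite /galg_mul big1 // => k _; rewrite msupp0 big_seq_fset0.
Qed.

Lemma galg_mulUU c1 c2 k1 k2 :
  galg_mul (mkmalgU k1 c1) (mkmalgU k2 c2) = mkmalgU (k1 * k2)%g (c1 * c2).
Proof. by rewrite (galg_mulw msuppU_le msuppU_le) !big_seq_fset1 !mcoeffUU. Qed.

Lemma galg_mul_suml (I : Type) (s : seq I) (f : I -> {malg F[G]}) g :
  galg_mul (\sum_(i <- s) f i) g = \sum_(i <- s) galg_mul (f i) g.
Proof.
exact: (big_morph (galg_mul^~ g) (fun _ _ => galg_mulDl _ _ _) (galg_mul0g _)).
Qed.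

Lemma galg_mul_sumr (I : Type) (s : seq I) (f : I -> {malg F[G]}) g :
  galg_mul g (\sum_(i <- s) f i) = \sum_(i <- s) galg_mul g (f i).
Proof.
exact: (big_morph (galg_mul g) (fun _ _ => galg_mulDr _ _ _) (galg_mulg0 _)).
Qed.

Lemma galg_mulA : associative galg_mul.
Proof.
move=> g1 g2 g3; rewrite (monalgE g1) (monalgE g2) (monalgE g3).
rewrite !galg_mul_suml; apply/eq_bigr=> k1 _.
rewrite [LHS]galg_mul_sumr (galg_mul_sumr (msupp g2)) galg_mul_suml.
apply/eq_bigr=> k2 _.
rewrite !galg_mul_sumr; apply/eq_bigr=> k3 _.
by rewrite !galg_mulUU mulrA mulgA.
Qed.

Lemma galg_mul1g : left_id galg1 galg_mul.
Proof.
move=> g; rewrite [in LHS](monalgE g) [RHS]monalgE galg_mul_sumr.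
by apply/eq_bigr=> k _; rewrite galg_mulUU mul1r mul1g.
Qed.

Lemma galg_mulg1 : right_id galg1 galg_mul.
Proof.
move=> g; rewrite [in LHS](monalgE g) [RHS]monalgE galg_mul_suml.
by apply/eq_bigr=> k _; rewrite galg_mulUU mulr1 mulg1.
Qed.

Lemma galg1_neq0 : galg1 != 0.
Proof. by rewrite monalgU_eq0 oner_eq0. Qed.

HB.instance Definition _ := GRing.Zmodule_isNzRing.Build (group_algebra F G)
  galg_mulA galg_mul1g galg_mulg1 galg_mulDl galg_mulDr galg1_neq0.

Lemma galgZU c c' k : c *: mkmalgU k c' = mkmalgU k (c * c') :> {malg F[G]}.
Proof. by apply/malgP=> k'; rewrite mcoeffZ !mcoeffU mulrnAr. Qed.

Lemma galg_mulZl c g1 g2 : c *: galg_mul g1 g2 = galg_mul (c *: g1) g2.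
Proof.
rewrite (@galg_mulw _ (msupp g2) _ _ (msuppZ_le c g1)) // scaler_sumr.
apply/eq_bigr=> k1 _; rewrite scaler_sumr; apply/eq_bigr=> k2 _.
by rewrite galgZU mcoeffZ mulrA.
Qed.

Lemma galg_mulZr c g1 g2 : c *: galg_mul g1 g2 = galg_mul g1 (c *: g2).
Proof.
rewrite (@galg_mulw (msupp g1) _ _ _ _ (msuppZ_le c g2)) // scaler_sumr.
apply/eq_bigr=> k1 _; rewrite scaler_sumr; apply/eq_bigr=> k2 _.
by rewrite galgZU mcoeffZ mulrCA.
Qed.

HB.instance Definition _ :=
  GRing.Lmodule_isLalgebra.Build F (group_algebra F G) galg_mulZl.
HB.instance Definition _ :=
  GRing.Lalgebra_isAlgebra.Build F (group_algebra F G) galg_mulZr.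

End GroupAlgebra.

(* F<x_0, ..., x_(d-1)>, as the monoid algebra of the free monoid on 'I_d. *)
Notation ncpoly F d := {malg F[{fmonom 'I_d}]}.

Definition nceval (F : fieldType) (d : nat) (A : algType F) (a : 'I_d -> A)
    (p : ncpoly F d) : A :=
  mmap (in_alg A) (fun m : {fmonom 'I_d} => \prod_(i <- m) a i) p.

Definition in_two_sided_ideal (S : nzRingType) (r : nat) (P : 'I_r -> S)
    (p : S) : Prop :=
  exists s : seq (S * 'I_r * S), p = \sum_(t <- s) t.1.1 * P t.1.2 * t.2.

(* x_i |-> a i induces an isomorphism F<x> / (P_0, ..., P_(r-1)) ~ A. *)
Definition presents_algebra (F : fieldType) (d r : nat)
    (P : 'I_r -> ncpoly F d) (A : algType F) (a : 'I_d -> A) : Prop :=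
  (forall y, exists p, nceval a p = y) /\
  (forall p, nceval a p = 0 <-> in_two_sided_ideal P p).

(* Words in the letters x_i^{+-1}, possibly unreduced: (i, false) stands for
   x_i and (i, true) for its inverse. *)
Definition gword (d : nat) := seq ('I_d * bool).

Definition gword_eval (d : nat) (G : groupType) (g : 'I_d -> G)
    (w : gword d) : G :=
  (\prod_(l <- w) (if l.2 then (g l.1)^-1 else g l.1))%g.

(* The congruence on words whose quotient is <x | P>. *)
Inductive gword_cong (d r : nat) (P : 'I_r -> gword d) :
    gword d -> gword d -> Prop :=
| GCrefl u : gword_cong P u u
| GCsym u v : gword_cong P u v -> gword_cong P v u
| GCtrans u v w : gword_cong P u v -> gword_cong P v w -> gword_cong P u w
| GCcat u u' v v' :
    gword_cong P u u' -> gword_cong P v v' -> gword_cong P (u ++ v) (u' ++ v')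
| GCcancel i b : gword_cong P [:: (i, b); (i, ~~ b)] [::]
| GCrel j : gword_cong P (P j) [::].

(* x_i |-> g i induces an isomorphism <x | P> ~ G. *)
Definition presents_group (d r : nat) (P : 'I_r -> gword d) (G : groupType)
    (g : 'I_d -> G) : Prop :=
  (forall y, exists w, gword_eval g w = y) /\
  (forall u v, gword_eval g u = gword_eval g v <-> gword_cong P u v).

Definition gword_mx (F : fieldType) (d n : nat) (A : 'I_d -> 'M[F]_n.+1)
    (w : gword d) : 'M[F]_n.+1 :=
  \prod_(l <- w) (if l.2 then (A l.1)^-1 else A l.1).

Definition rk (R : realType) (F : fieldType) (n : nat) (A : 'M[F]_n) : R :=
  (\rank A)%:R / n%:R.

(* The N x N matrix extending A by zero; indices start at 0. *)
Definition mx_hat (F : fieldType) (n : nat) (A : 'M[F]_n) (i j : nat) : F :=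
  match insub i, insub j with
  | Some i', Some j' => A i' j'
  | _, _ => 0
  end.

(* The rank of mx_hat A - mx_hat B, computed on a finite corner that contains
   its support. *)
Definition rank_hat_sub (F : fieldType) (n m : nat)
    (A : 'M[F]_n) (B : 'M[F]_m) : nat :=
  \rank (\matrix_(i < maxn n m, j < maxn n m) (mx_hat A i j - mx_hat B i j)).

(* Sizes n >= 1 are written n.+1. *)
Definition rank_stable_relations (R : realType) (F : fieldType) (d r : nat)
    (P : 'I_r -> ncpoly F d) : Prop :=
  forall eps : R, 0 < eps -> exists2 delta : R, 0 < delta &
    forall (n : nat) (A : 'I_d -> 'M[F]_n.+1),
      (forall i, rk R (nceval A (P i)) < delta) ->
      exists (n' : nat) (B : 'I_d -> 'M[F]_n'.+1),
        (forall i, nceval B (P i) = 0) /\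
        (forall i, (rank_hat_sub (A i) (B i))%:R < eps * n.+1%:R).

Definition rank_stable_algebra (R : realType) (F : fieldType)
    (A : algType F) : Prop :=
  exists (d r : nat) (P : 'I_r -> ncpoly F d) (a : 'I_d -> A),
    presents_algebra P a /\ rank_stable_relations R P.

Definition rank_stable_group (R : realType) (F : fieldType) (d r : nat)
    (P : 'I_r -> gword d) : Prop :=
  forall eps : R, 0 < eps -> exists2 delta : R, 0 < delta &
    forall (n : nat) (A : 'I_d -> 'M[F]_n.+1),
      (forall i, A i \in unitmx) ->
      (forall j, rk R (gword_mx A (P j) - 1%:M) < delta) ->
      exists (n' : nat) (B : 'I_d -> 'M[F]_n'.+1),
        [/\ forall i, B i \in unitmx,
            forall i, (rank_hat_sub (A i) (B i))%:R < eps * n.+1%:R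
          & forall j, gword_mx B (P j) = 1%:M].

(* Main.v *)
(* F[G] is presented by the letters x_i, y_i with the relations x_i y_i = 1,
   y_i x_i = 1 and P_j(x, y) = 1. If the group is stable and (A_i, A'_i) almost
   satisfy these relations, A_i is close to an invertible C_i whose inverse is
   close to A'_i; solving the group relations near C gives B, and inversion
   increases the rank distance at most threefold.

   Conversely, let F[G] have a stable presentation P'. Expressing each family of
   generators through the other one by polynomials q and p, an almost solution
   A of the group relations gives the almost solution q(A) of P', hence a
   solution B' of P' near q(A), and p(B') is a solution near p(q(A)), hence near
   A. For the last step the size of B' has to be close to that of A, because
   the constant terms of p are scalar matrices. This can be arranged: if B' is
   much too large, it is compressed to an invariant subspace containing the
   image of B' and the first coordinates; if it is much too small, the constant
   terms of P' must vanish, so that B' can be padded with zeros. *)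

Require Import Defs.
From HB Require Import structures.
From mathcomp Require Import all_boot all_order all_algebra.
From mathcomp Require Import finmap reals zify.
From mathcomp.multinomials Require Import monalg.

Set Implicit Arguments.
Unset Strict Implicit.
Unset Printing Implicit Defensive.

Import Order.TTheory GRing.Theory Num.Theory.

Local Open Scope ring_scope.

(** * Free algebra: substitution and evaluation *)

(* monalg makes {malg F[K]} an algebra over F only for commutative K, and
   substituting polynomials into polynomials needs an algType. *)
Definition ncalg (F : fieldType) (d : nat) : Type := ncpoly F d.

HB.instance Definition _ (F : fieldType) (d : nat) :=
  GRing.Lalgebra.copy (ncalg F d) (ncpoly F d).

HB.lock Definition ncX (F : fieldType) (d : nat) (i : 'I_d) : ncalg F d :=
  mkmalgU (FMonom [:: i]) 1.

Section NcAlgebra.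
Variables (F : fieldType) (d : nat).
Implicit Types (p q : ncalg F d) (c : F).

Lemma ncmulUU c1 c2 (m1 m2 : {fmonom 'I_d}) :
  (mkmalgU m1 c1 : ncalg F d) * (mkmalgU m2 c2 : ncalg F d) =
  mkmalgU (FMonom (m1 ++ m2)) (c1 * c2).
Proof. by rewrite -fmmulE; exact: fgmulUU. Qed.

Lemma ncscaleU c c' (m : {fmonom 'I_d}) :
  c *: (mkmalgU m c' : ncalg F d) = mkmalgU m (c * c').
Proof. by apply/malgP => k; rewrite mcoeffZ !mcoeffU mulrnAr. Qed.

Lemma ncalgE p : p = \sum_(m <- msupp p) (mkmalgU m p@_m : ncalg F d).
Proof. exact: monalgE. Qed.

Lemma ncscaleAr c p q : c *: (p * q) = p * (c *: q).
Proof.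
have comm_c : p * malgC c = c *: p.
  rewrite [RHS]malgZ_def [LHS]fgmulgU; apply: eq_bigr => m _.
  by rewrite mulrC mulm1.
by rewrite -mul_malgC mulrA -mul_malgC mulrA comm_c -mul_malgC.
Qed.

HB.instance Definition _ :=
  GRing.Lalgebra_isAlgebra.Build F (ncalg F d) ncscaleAr.

Lemma ncmonomE (s : seq 'I_d) :
  mkmalgU (FMonom s) 1 = \prod_(i <- s) ncX F i.
Proof.
elim: s => [|i s IHs]; first by rewrite big_nil -fmoneE.
by rewrite big_cons -IHs ncX.unlock ncmulUU mul1r.
Qed.

(** Works because every polynomial is a sum of scalar multiples of products of letters. It reduces
    statements about evaluation to constants, letters, sums and products. *)
Lemma ncalg_ind (Pr : ncalg F d -> Prop) :
  (forall c, Pr c%:A) -> (forall i, Pr (ncX F i)) ->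
  (forall p q, Pr p -> Pr q -> Pr (p + q)) ->
  (forall p q, Pr p -> Pr q -> Pr (p * q)) -> forall p, Pr p.
Proof.
move=> PC PX PD PM p; rewrite (ncalgE p); elim/big_ind: _ => //.
  by have := PC 0; rewrite scale0r.
move=> [s] _ /=; rewrite -[_@__]mulr1 -ncscaleU -mulr_algl.
apply: (PM) => //; rewrite ncmonomE; elim/big_ind: _ => //.
by have := PC 1; rewrite scale1r.
Qed.

Section Eval.
Variables (A : algType F) (a : 'I_d -> A).

Lemma nceval_monom (s : seq 'I_d) c :
  nceval a (mkmalgU (FMonom s) c) = c *: \prod_(i <- s) a i.
Proof. by rewrite /nceval mmapU mulr_algl. Qed.

Lemma ncevalB (p q : ncalg F d) : nceval a (p - q) = nceval a p - nceval a q.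
Proof. exact: mmapB. Qed.

Lemma ncevalD (p q : ncalg F d) : nceval a (p + q) = nceval a p + nceval a q.
Proof. exact: mmapD. Qed.

Lemma nceval_sum (I : Type) (s : seq I) (f : I -> ncalg F d) :
  nceval a (\sum_(i <- s) f i) = \sum_(i <- s) nceval a (f i).
Proof. exact: raddf_sum. Qed.

Lemma ncevalM (p q : ncalg F d) : nceval a (p * q) = nceval a p * nceval a q.
Proof.
rewrite (ncalgE p) (ncalgE q) mulr_suml !nceval_sum mulr_suml.
apply: eq_bigr => -[s1] _; rewrite mulr_sumr nceval_sum mulr_sumr.
apply: eq_bigr => -[s2] _.
by rewrite ncmulUU !nceval_monom big_cat -scalerAl -scalerAr scalerA.
Qed.

Lemma ncevalC c : nceval a (c%:A : ncalg F d) = c%:A.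
Proof.
have -> : (c%:A : ncalg F d) = mkmalgU (FMonom [::]) c.
  by have := ncmonomE [::]; rewrite big_nil => <-; rewrite ncscaleU mulr1.
by rewrite nceval_monom big_nil.
Qed.

Lemma nceval1 : nceval a (1 : ncalg F d) = 1.
Proof. by rewrite -[1]scale1r ncevalC scale1r. Qed.

Lemma ncevalZ c (p : ncalg F d) : nceval a (c *: p) = c *: nceval a p.
Proof. by rewrite -mulr_algl ncevalM ncevalC mulr_algl. Qed.

Lemma ncevalX i : nceval a (ncX F i) = a i.
Proof. by rewrite ncX.unlock nceval_monom scale1r big_seq1. Qed.

Lemma nceval_prod (I : Type) (s : seq I) (f : I -> ncalg F d) :
  nceval a (\prod_(i <- s) f i) = \prod_(i <- s) nceval a (f i).
Proof. exact: (big_morph _ ncevalM nceval1). Qed.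

End Eval.
End NcAlgebra.

(** Both sides are algebra morphisms in [p] that agree on constants and letters. *)
Lemma nceval_comp (F : fieldType) (d e : nat) (A : algType F)
    (a : 'I_e -> A) (q : 'I_d -> ncalg F e) (p : ncalg F d) :
  nceval a (nceval q p : ncalg F e) = nceval (fun i => nceval a (q i)) p.
Proof.
elim/ncalg_ind: p => [c|i|p1 p2 IH1 IH2|p1 p2 IH1 IH2].
- by rewrite (ncevalC q) !ncevalC.
- by rewrite (ncevalX q) ncevalX.
- rewrite (ncevalD q p1 p2) (ncevalD a (nceval q p1)) [RHS]ncevalD.
  exact: congr2 IH1 IH2.
- rewrite (ncevalM q p1 p2) (ncevalM a (nceval q p1)) [RHS]ncevalM.
  exact: congr2 IH1 IH2.
Qed.

Lemma eq_nceval (F : fieldType) (d : nat) (A : algType F) (a b : 'I_d -> A)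
  (p : ncalg F d) : a =1 b -> nceval a p = nceval b p.
Proof.
move=> eab; rewrite /nceval /mmap; apply: eq_bigr => m _; congr (_ * _).
by apply: eq_bigr => i _.
Qed.

(** * Two-sided ideals *)

Section Ideal.
Variables (S : nzRingType) (r : nat) (P : 'I_r -> S).
Local Notation ideal := (in_two_sided_ideal P).

Lemma ideal0 : ideal 0.
Proof. by exists [::]; rewrite big_nil. Qed.

Lemma ideal_gen i : ideal (P i).
Proof. by exists [:: (1, i, 1)]; rewrite big_seq1 mul1r mulr1. Qed.

Lemma idealD p q : ideal p -> ideal q -> ideal (p + q).
Proof. by move=> [s ->] [t ->]; exists (s ++ t); rewrite big_cat. Qed.

Lemma idealM q1 q2 p : ideal p -> ideal (q1 * p * q2).
Proof.
move=> [s ->]; exists [seq (q1 * t.1.1, t.1.2, t.2 * q2) | t <- s].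
rewrite mulr_sumr mulr_suml big_map; apply: eq_bigr => t _.
by rewrite !mulrA.
Qed.

Lemma idealMl q p : ideal p -> ideal (q * p).
Proof. by move/(idealM q 1); rewrite mulr1. Qed.

Lemma idealMr q p : ideal p -> ideal (p * q).
Proof. by move/(idealM 1 q); rewrite mul1r. Qed.

Lemma idealN p : ideal p -> ideal (- p).
Proof. by rewrite -mulN1r; apply: idealMl. Qed.

Lemma ideal_sum (I : Type) (s : seq I) (f : I -> S) :
  (forall i, ideal (f i)) -> ideal (\sum_(i <- s) f i).
Proof.
by move=> idf; elim/big_ind: _ => //; [exact: ideal0 | exact: idealD].
Qed.

(** Follows from [p q - p' q' = (p - p') q + p' (q - q')]: congruence modulo the ideal respects
    products. *)
Lemma ideal_subM p p' q q' :
  ideal (p - p') -> ideal (q - q') -> ideal (p * q - p' * q').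
Proof.
move=> idp idq; rewrite -(subrKA (p' * q)) -mulrBl -mulrBr.
by apply: idealD; [exact: idealMr | exact: idealMl].
Qed.

End Ideal.

Lemma idealZ (F : fieldType) (S : algType F) (r : nat) (P : 'I_r -> S) c p :
  in_two_sided_ideal P p -> in_two_sided_ideal P (c *: p).
Proof. by move/(idealMl c%:A); rewrite mulr_algl. Qed.

Lemma nceval_ideal (F : fieldType) (d r : nat) (P : 'I_r -> ncalg F d)
    (A : algType F) (a : 'I_d -> A) p :
  (forall i, nceval a (P i) = 0) -> in_two_sided_ideal P p -> nceval a p = 0.
Proof.
move=> P0 [s ->]; rewrite (nceval_sum a) big1 // => t _.
by rewrite (ncevalM a (_ * _)) (ncevalM a) P0 mulr0 mul0r.
Qed.

(** * Zero-padding and the rank distance between matrices of different sizes *)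

Section Hat.
Variable F : fieldType.

(** For [n <= N] this pads [A] with zeros, for [N < n] it cuts out a corner. Writing it with
    rectangular partial identities turns the laws of padding into matrix identities. *)
Definition hat (N n : nat) (A : 'M[F]_n) : 'M[F]_N :=
  pid_mx n *m A *m pid_mx n.

Lemma mul_pid_inj n N : (n <= N)%N ->
  (pid_mx n : 'M[F]_(n, N)) *m (pid_mx n : 'M_(N, n)) = 1%:M.
Proof. by move=> leN; rewrite mul_pid_mx minnn (minn_idPr leN) pid_mx_1. Qed.

Lemma mx_hatE N n (A : 'M[F]_n) (i j : 'I_N) : hat N A i j = mx_hat A i j.
Proof.
have pidE p (M : 'M[F]_(n, p)) (k : 'I_N) (l : 'I_p) :
    (pid_mx n *m M) k l = if insub (k : nat) is Some k' then M k' l else 0.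
  rewrite mxE; case: insubP => [k' ltk kk'|/negbTE gek].
    rewrite (bigD1 k') //= big1 => [|k'' nek]; rewrite mxE.
      by rewrite -kk' eqxx ltn_ord mul1r addr0.
    rewrite -kk' -[(_ == _ :> nat)]/(k' == k'') eq_sym (negbTE nek) andFb.
    by rewrite mul0r.
  by apply: big1 => l' _; rewrite mxE gek andbF mul0r.
rewrite /hat -mulmxA pidE /mx_hat; case: insubP => // i' _ _.
(* Columns are reduced to the row statement [pidE] by transposition. *)
rewrite -[_ *m _]trmxK trmx_mul tr_pid_mx mxE pidE.
by case: insubP => // j' _ _; rewrite mxE.
Qed.

Lemma hat_id n (A : 'M[F]_n) : hat n A = A.
Proof. by rewrite /hat pid_mx_1 mulmx1 mul1mx. Qed.

Lemma hatB N n (A B : 'M[F]_n) : hat N (A - B) = hat N A - hat N B.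
Proof. by rewrite /hat mulmxBr mulmxBl. Qed.

Lemma hatD N n (A B : 'M[F]_n) : hat N (A + B) = hat N A + hat N B.
Proof. by rewrite /hat mulmxDr mulmxDl. Qed.

Lemma hatZ N n c (A : 'M[F]_n) : hat N (c *: A) = c *: hat N A.
Proof. by rewrite /hat -scalemxAr -scalemxAl. Qed.

Lemma hatM N n (A B : 'M[F]_n) : (n <= N)%N ->
  hat N (A *m B) = hat N A *m hat N B.
Proof.
move=> leN; rewrite /hat !mulmxA -[_ *m pid_mx n *m pid_mx n]mulmxA.
by rewrite mul_pid_inj // mulmx1.
Qed.

Lemma hat1 N n : (n <= N)%N -> hat N (1%:M : 'M[F]_n) = pid_mx n.
Proof. by move=> leN; rewrite /hat mulmx1 pid_mx_id. Qed.

Lemma hat_hat N M n (A : 'M[F]_n) : (n <= M)%N -> hat N (hat M A) = hat N A.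
Proof.
move=> leM; have [e1 e2] : minn M (minn M n) = n /\ minn M (minn n M) = n.
  by split; lia.
by rewrite /hat !mulmxA mul_pid_mx e1 -!mulmxA mul_pid_mx e2 mulmxA.
Qed.

Lemma mxrank_pid_mulr m n p (A : 'M[F]_n) :
  (\rank (pid_mx m *m A *m (pid_mx m : 'M_(n, p)) : 'M_p) <= \rank A)%N.
Proof. exact: leq_trans (mxrankM_maxl _ _) (mxrankM_maxr _ _). Qed.

(** Padding and then cutting back returns [A], and neither operation increases the rank. *)
Lemma mxrank_hat N n (A : 'M[F]_n) : (n <= N)%N -> \rank (hat N A) = \rank A.
Proof.
move=> leN; apply/eqP; rewrite eqn_leq mxrank_pid_mulr.
by rewrite -{1}[A]hat_id -(hat_hat n A leN) mxrank_pid_mulr.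
Qed.

(** Padding beyond the size [maxn n m] keeps the rank, so matrices of several sizes can be compared
    inside one common size [N]. *)
Lemma rank_hat_subE N n m (A : 'M[F]_n) (B : 'M[F]_m) :
  (n <= N)%N -> (m <= N)%N -> rank_hat_sub A B = \rank (hat N A - hat N B).
Proof.
move=> leN leM; pose M := maxn n m.
have leMN : (M <= N)%N by rewrite geq_max leN leM.
have -> : hat N A - hat N B = hat N (hat M A - hat M B).
  by rewrite hatB !hat_hat ?leq_maxl ?leq_maxr.
rewrite mxrank_hat // /rank_hat_sub; congr (\rank _).
by apply/matrixP => i j; rewrite mxE -!mx_hatE [RHS]mxE;
   congr (_ + _); rewrite [RHS]mxE.
Qed.

Lemma rank_hat_sub_same n (A B : 'M[F]_n) : rank_hat_sub A B = \rank (A - B).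
Proof. by rewrite (@rank_hat_subE n) // !hat_id. Qed.

Lemma mxrankB m n (A B : 'M[F]_(m, n)) :
  (\rank (A - B)%R <= \rank A + \rank B)%N.
Proof. by rewrite -[\rank B]mxrank_opp mxrank_add. Qed.

Lemma rank_hat_sub_trans n m k (B : 'M[F]_m) (A : 'M[F]_n) (C : 'M[F]_k) :
  (rank_hat_sub A C <= rank_hat_sub A B + rank_hat_sub B C)%N.
Proof.
pose N := maxn n (maxn m k).
have [leA leB leC] : [/\ n <= N, m <= N & k <= N]%N by rewrite /N; split; lia.
rewrite !(@rank_hat_subE N) //.
by rewrite -[X in (\rank X <= _)%N](subrKA (hat N B)) mxrank_add.
Qed.

Lemma rank_hat_subC n m (A : 'M[F]_n) (B : 'M[F]_m) :
  rank_hat_sub A B = rank_hat_sub B A.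
Proof.
rewrite !(@rank_hat_subE (maxn n m)) ?leq_maxl ?leq_maxr //.
by rewrite -mxrank_opp opprB.
Qed.

Lemma rank_hat_subD n m (A A' : 'M[F]_n) (B B' : 'M[F]_m) :
  (rank_hat_sub (A + A') (B + B') <= rank_hat_sub A B + rank_hat_sub A' B')%N.
Proof.
rewrite !(@rank_hat_subE (maxn n m)) ?leq_maxl ?leq_maxr // !hatD.
by rewrite opprD addrACA mxrank_add.
Qed.

(** Uses [a a' - b b' = (a - b) a' + b (a' - b')] on the padded matrices; padding is
    multiplicative. *)
Lemma rank_hat_subM n m (A A' : 'M[F]_n) (B B' : 'M[F]_m) :
  (rank_hat_sub (A *m A') (B *m B') <=
     rank_hat_sub A B + rank_hat_sub A' B')%N.
Proof.
rewrite !(@rank_hat_subE (maxn n m)) ?leq_maxl ?leq_maxr //.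
rewrite !hatM ?leq_maxl ?leq_maxr //; set a := hat _ A; set b := hat _ B.
rewrite -(subrKA (b *m hat _ A')) -mulmxBl -mulmxBr.
apply: leq_trans (mxrank_add _ _) _.
by apply: leq_add; rewrite (mxrankM_maxl, mxrankM_maxr).
Qed.

(** The padded matrices differ only in the diagonal entries where just one of them is supported.
    This is the price of constant terms when the sizes differ. *)
Lemma rank_hat_sub_scalar n m (c : F) :
  (rank_hat_sub (c%:M : 'M[F]_n) (c%:M : 'M[F]_m) <= (n - m) + (m - n))%N.
Proof.
wlog lenm : n m / (n <= m)%N.
  by move=> IH; case: (leqP n m) => [|/ltnW] /IH //;
     rewrite rank_hat_subC addnC.
rewrite (@rank_hat_subE m) // hat_id -scalemx1 -[in X in (_ - X)]scalemx1.
rewrite hatZ hat1 // -scalerBr.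
apply: leq_trans (mxrank_scale _ _) _; rewrite -mxrank_opp opprB.
by rewrite rank_copid_mx //; lia.
Qed.

End Hat.

(** * Rank estimates for evaluated polynomials *)

(** Sums and products at most add rank distances, so induction on [p] gives a constant independent
    of the sizes; the bound on the size difference pays for the constants. *)
Lemma nceval_lipschitz (F : fieldType) (d : nat) (p : ncalg F d) :
  exists C, forall n m (A : 'I_d -> 'M[F]_n.+1) (B : 'I_d -> 'M[F]_m.+1) t,
    (forall i, rank_hat_sub (A i) (B i) <= t)%N ->
    ((n - m) + (m - n) <= t)%N ->
    (rank_hat_sub (nceval A p) (nceval B p) <= C * t)%N.
Proof.
elim/ncalg_ind: p => [c|i|p q [C IHp] [D IHq]|p q [C IHp] [D IHq]].
- exists 1%N => n m A B t _ let_; rewrite (ncevalC A) (ncevalC B) mul1n.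
  have scalarE k : c%:A = c%:M :> 'M[F]_k.+1 by rewrite -scalemx1.
  by rewrite !scalarE; apply: (leq_trans (rank_hat_sub_scalar _ _ _));
     rewrite !subSS.
- by exists 1%N => n m A B t leAB _; rewrite (ncevalX A) (ncevalX B) mul1n.
- exists (C + D)%N => n m A B t leAB let_.
  rewrite (ncevalD A) (ncevalD B) mulnDl.
  apply: (leq_trans (rank_hat_subD _ _ _ _)).
  by apply: leq_add; [exact: IHp | exact: IHq].
- exists (C + D)%N => n m A B t leAB let_.
  rewrite (ncevalM A) (ncevalM B) mulnDl.
  apply: (leq_trans (rank_hat_subM _ _ _ _)).
  by apply: leq_add; [exact: IHp | exact: IHq].
Qed.

(** Multiplying a relation on both sides cannot raise its rank, so [C] is the number of terms in an
    expression of [p] through the relations. *)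
Lemma rank_nceval_ideal (F : fieldType) (d r : nat) (P : 'I_r -> ncalg F d)
    (p : ncalg F d) : in_two_sided_ideal P p ->
  exists C, forall n (A : 'I_d -> 'M[F]_n.+1) t,
    (forall i, \rank (nceval A (P i)) <= t)%N ->
    (\rank (nceval A p) <= C * t)%N.
Proof.
move=> [s ->]; exists (size s) => n A t leP; rewrite (nceval_sum A).
elim: s => [|u s IHs]; first by rewrite big_nil mxrank0.
rewrite big_cons /= mulSn; apply: leq_trans (mxrank_add _ _) (leq_add _ IHs).
rewrite (ncevalM A (_ * _)) (ncevalM A).
apply: leq_trans (mxrankM_maxl _ _) _.
by apply: leq_trans (mxrankM_maxr _ _) (leP _).
Qed.

Lemma uniform_bound (r : nat) (bd : 'I_r -> nat -> Prop) :
  (forall i C D, (C <= D)%N -> bd i C -> bd i D) ->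
  (forall i, exists C, bd i C) -> exists C, forall i, bd i C.
Proof.
move=> mono /fin_all_exists[C bdC]; exists (\max_i C i)%N => i.
exact: mono (leq_bigmax i) (bdC i).
Qed.

(** * Adjusting the size of an exact solution *)

Section SizeAdjustment.
Variables (F : fieldType) (d : nat).

Lemma nceval_intertwine n m (U : 'M[F]_(n.+1, m.+1)) (B : 'I_d -> 'M[F]_n.+1)
    (C : 'I_d -> 'M[F]_m.+1) (p : ncalg F d) :
  (forall k, B k *m U = U *m C k) -> nceval B p *m U = U *m nceval C p.
Proof.
move=> BUC; elim/ncalg_ind: p => [c|i|p q IHp IHq|p q IHp IHq].
- rewrite (ncevalC B) (ncevalC C) -scalemxAl -scalemxAr.
  by rewrite [_ *m 1]mulmx1 [1 *m _]mul1mx.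
- by rewrite (ncevalX B) (ncevalX C) BUC.
- by rewrite (ncevalD B) (ncevalD C) mulmxDl IHp IHq -mulmxDr.
- rewrite (ncevalM B) (ncevalM C) -[_ * _]/(_ *m _) -[X in _ = U *m X]/(_ *m _).
  by rewrite -mulmxA IHq mulmxA IHp mulmxA.
Qed.

(** [F^o] is [F] as an algebra over itself; the constant term is the value at zero. *)
Definition constant_term (p : ncalg F d) : F := nceval (fun=> 0 : F^o) p.

(** A padded tuple is block diagonal with blocks [B k] and [0], so [p] acts on the second block as
    its constant term; [copid_mx n.+1] is the identity of that block. *)
Lemma nceval_hat n N (B : 'I_d -> 'M[F]_n.+1) (p : ncalg F d) : (n <= N)%N ->
  nceval (fun k => hat N.+1 (B k)) p =
  hat N.+1 (nceval B p) + constant_term p *: copid_mx n.+1.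
Proof.
move=> leN; rewrite /constant_term.
have copidK : copid_mx n.+1 *m copid_mx n.+1 = copid_mx n.+1 :> 'M[F]_N.+1.
  exact: copid_mx_id.
elim/ncalg_ind: p => [c|i|p q IHp IHq|p q IHp IHq].
- rewrite (ncevalC (fun k => hat N.+1 (B k))) (ncevalC B).
  rewrite (ncevalC (fun=> 0 : F^o)) hatZ hat1 //.
  by rewrite -[c%:A in RHS]/(c * 1) mulr1 -scalerDr addrC subrK.
- rewrite (ncevalX (fun k => hat N.+1 (B k))) (ncevalX B).
  by rewrite (ncevalX (fun=> 0 : F^o)) scale0r addr0.
- rewrite (ncevalD (fun k => hat N.+1 (B k))) (ncevalD B).
  by rewrite (ncevalD (fun=> 0 : F^o)) IHp IHq hatD scalerDl addrACA.
- rewrite (ncevalM (fun k => hat N.+1 (B k))) (ncevalM B).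
  rewrite (ncevalM (fun=> 0 : F^o)) IHp IHq hatM //.
  set cp := nceval _ p; set cq := nceval _ q.
  rewrite -[LHS]/(_ *m _) mulmxDl !mulmxDr -!scalemxAl -!scalemxAr copidK.
  rewrite scalerA /hat -!mulmxA mul_pid_mx_copid // !mulmx0 !scaler0 addr0.
  by rewrite !mulmxA mul_copid_mx_pid // !mul0mx scaler0 add0r.
Qed.

(* C is the compression of B to the smallest subspace that contains the first
   n coordinates and the image of B; U is the inclusion of that subspace. *)
Lemma compress n m (A : 'I_d -> 'M[F]_n.+1) (B : 'I_d -> 'M[F]_m.+1) :
  (n <= m)%N ->
  exists s (C : 'I_d -> 'M[F]_((n + s).+1)) (U : 'M[F]_(m.+1, (n + s).+1))
    (T : 'M[F]_((n + s).+1, m.+1)),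
  [/\ (s <= \sum_k rank_hat_sub (A k) (B k))%N, T *m U = 1%:M,
      forall k, B k *m U = U *m C k
    & forall k, (rank_hat_sub (A k) (C k) <= rank_hat_sub (A k) (B k))%N].
Proof.
move=> lenm; pose E : 'M[F]_(m.+1, n.+1) := pid_mx n.+1.
pose Et : 'M[F]_(n.+1, m.+1) := pid_mx n.+1.
have EtE : Et *m E = 1%:M by apply: mul_pid_inj.
pose Q : 'M[F]_m.+1 := copid_mx n.+1.
have QE : Q *m E = 0 by apply: mul_copid_mx_pid.
have EtQ : Et *m Q = 0 by apply: mul_pid_mx_copid.
have defQ : Q = 1%:M - E *m Et by rewrite /Q /copid_mx /E /Et pid_mx_id.
have Q_idem : Q *m Q = Q by apply: copid_mx_id.
(* Row spaces of transposes encode the sum of the column spaces of the [Q *m B k], the part of the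
   image outside the first coordinates. *)
pose M : 'M[F]_m.+1 := (\sum_k <<(Q *m B k)^T>>)%MS.
pose s := \rank M; pose U2 : 'M[F]_(m.+1, s) := (row_base M)^T.
have [T2 T2U2] : exists T2 : 'M_(s, m.+1), T2 *m U2 = 1%:M.
  have /row_freeP[X defX] := row_base_free M.
  by exists X^T; rewrite /U2 -trmx_mul defX trmx1.
have QB k : exists X, Q *m B k = U2 *m X.
  have /submxP[X defX] : ((Q *m B k)^T <= row_base M)%MS.
    rewrite eq_row_base; apply: (sumsmx_sup k) => //.
    by rewrite genmxE.
  by exists X^T; rewrite -trmx_mul -defX trmxK.
have QU2 : Q *m U2 = U2.
  suff /submxP[X defX] : (row_base M <= Q^T)%MS.
    by rewrite /U2 defX trmx_mul trmxK mulmxA Q_idem.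
  rewrite eq_row_base; apply/sumsmx_subP => k _; rewrite genmxE trmx_mul.
  exact: submxMl.
have EtU2 : Et *m U2 = 0 by rewrite -QU2 mulmxA EtQ mul0mx.
pose U : 'M[F]_(m.+1, n.+1 + s) := row_mx E U2.
pose T : 'M[F]_(n.+1 + s, m.+1) := col_mx Et (T2 *m Q).
have TU : T *m U = 1%:M.
  by rewrite mul_col_row EtE EtU2 -!mulmxA QE QU2 T2U2 mulmx0 -scalar_mx_block.
(* [U *m T] fixes the image of each [B k]; hence the range of [U] is invariant and [T *m B k *m U]
   is the restriction of [B k] to it. *)
have UTB k : U *m T *m B k = B k.
  rewrite mul_row_col mulmxDl -!mulmxA; have [X defX] := QB k.
  rewrite defX [T2 *m _]mulmxA T2U2 mul1mx -defX.
  by rewrite mulmxA -mulmxDl defQ addrC subrK mul1mx.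
exists s, (fun k => T *m B k *m U), U, T; split=> //.
- apply: leq_trans (_ : \sum_k \rank <<(Q *m B k)^T>> <= _)%N.
    exact: mxrank_sum_leqif.
  apply: leq_sum => k _; rewrite genmxE mxrank_tr.
  rewrite (@rank_hat_subE _ m.+1) // hat_id.
  (* [Q] kills the padded [A k], so the rank of [Q *m B k] is at most the distance from [A k] to
     [B k]. *)
  have -> : Q *m B k = - (Q *m (hat m.+1 (A k) - B k)).
    rewrite mulmxBr /hat !mulmxA mul_copid_mx_pid // !mul0mx add0r opprK.
    by [].
  by rewrite mxrank_opp mxrankM_maxr.
- by move=> k; rewrite !mulmxA UTB.
- move=> k; rewrite (@rank_hat_subE _ (n.+1 + s)) ?leq_addr // hat_id.
  rewrite (@rank_hat_subE _ m.+1) // hat_id.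
  have -> : hat (n.+1 + s) (A k) = T *m hat m.+1 (A k) *m U.
    have TE : T *m E = pid_mx n.+1.
      by rewrite mul_col_mx EtE -mulmxA QE mulmx0 pid_mx_col.
    have EtU : Et *m U = pid_mx n.+1.
      by rewrite mul_mx_row EtE EtU2 pid_mx_row.
    by rewrite /hat !mulmxA -/E TE -(mulmxA _ _ U) EtU.
  rewrite -mulmxBl -mulmxBr.
  exact: leq_trans (mxrankM_maxl _ _) (mxrankM_maxr _ _).
Qed.

Lemma size_adjust r (P : 'I_r -> ncalg F d) :
  exists K, forall n m (A : 'I_d -> 'M[F]_n.+1) (B : 'I_d -> 'M[F]_m.+1) t,
    (forall l, \rank (nceval A (P l)) <= t)%N ->
    (forall l, nceval B (P l) = 0) ->
    (forall k, rank_hat_sub (A k) (B k) <= t)%N ->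
    exists m' (B' : 'I_d -> 'M[F]_m'.+1),
      [/\ forall l, nceval B' (P l) = 0,
          forall k, (rank_hat_sub (A k) (B' k) <= t)%N
        & (((n - m') + (m' - n))%N <= K * t)%N].
Proof.
have [C lipC] : exists C, forall l n (A B : 'I_d -> 'M[F]_n.+1) t,
    (forall i, rank_hat_sub (A i) (B i) <= t)%N ->
    (rank_hat_sub (nceval A (P l)) (nceval B (P l)) <= C * t)%N.
  apply: uniform_bound => [l C D leCD lipC n A B t leAB|l].
    exact: leq_trans (lipC _ _ _ _ leAB) (leq_mul _ _).
  have [C lipC] := nceval_lipschitz (P l); exists C => n A B t leAB.
  by apply: lipC => //; rewrite subnn.
(* Compression adds at most [d * t] dimensions; the case of a nonzero constant term costs at most
   [C.+1 * t]. *)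
exists (d + C.+1)%N => n m A B t PA PB AB; have [lenm|ltmn] := leqP n m.
  have [s [B' [U [T [les TU BU AB']]]]] := compress A B lenm.
  exists (n + s)%N, B'; split=> [l|k|].
  - rewrite -[LHS]mul1mx -TU -mulmxA -(nceval_intertwine _ BU) PB.
    by rewrite mul0mx mulmx0.
  - exact: leq_trans (AB' k) (AB k).
  have : (s <= d * t)%N.
    apply: leq_trans les _; rewrite -[d in (d * t)%N]card_ord -sum_nat_const.
    exact: leq_sum.
  by rewrite mulnDl; lia.
pose hB k := hat n.+1 (B k).
have hBE l : nceval hB (P l) = constant_term (P l) *: copid_mx m.+1.
  by rewrite (nceval_hat _ _ (ltnW ltmn)) PB -{1}(scale0r 0) hatZ scale0r add0r.
have AhB k : (rank_hat_sub (A k) (hB k) <= t)%N.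
  have := AB k; rewrite (@rank_hat_subE _ n.+1) // ?hat_id; last exact: ltnW.
  by rewrite rank_hat_sub_same.
(* If all constant terms vanish, the padded [hB] is still a solution and has the size of [A]. *)
have [/forallP c0|/forallPn[l cl]] :=
  boolP [forall l, constant_term (P l) == 0].
  exists n, hB; split=> // [l|]; last by rewrite subnn.
  by rewrite hBE (eqP (c0 l)) scale0r.
(* A nonzero constant term gives [P l] at [hB] the rank [n - m], but this value is within rank
   [C * t] of [P l] at [A], whose rank is at most [t]. So [B] already has nearly the right size. *)
exists m, B; split=> //.
have := lipC l n A hB t AhB; have := PA l.
rewrite rank_hat_sub_same hBE => leP leD.
pose cQ : 'M[F]_n.+1 := constant_term (P l) *: copid_mx m.+1.
have : (\rank cQ <= t + C * t)%N.
  rewrite -(subKr (nceval A (P l)) cQ).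
  exact: leq_trans (mxrankB _ _) (leq_add leP leD).
rewrite /cQ mxrank_scale_nz // rank_copid_mx; last exact: ltnW.
by rewrite mulnDl mulSn; lia.
Qed.

End SizeAdjustment.

(** * Presentation of the group algebra *)

(* In 'I_(d + d) the index i < d stands for x_i and d + i for its inverse. *)
Definition code (d : nat) (l : 'I_d * bool) : 'I_(d + d) :=
  unsplit (if l.2 then inr l.1 else inl l.1).

Definition decode (d : nat) (k : 'I_(d + d)) : 'I_d * bool :=
  match split k with inl i => (i, false) | inr i => (i, true) end.

Definition flip (d : nat) (l : 'I_d * bool) : 'I_d * bool := (l.1, ~~ l.2).

Lemma codeK d : cancel (@code d) (@decode d).
Proof. by move=> [i []]; rewrite /decode /code unsplitK. Qed.

Lemma decodeK d : cancel (@decode d) (@code d).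
Proof.
move=> k; rewrite /decode /code -[RHS]splitK.
by case: (split k).
Qed.

Section StandardPresentation.
Variables (F : fieldType) (d r : nat) (P : 'I_r -> gword d).

Definition ncword (w : gword d) : ncalg F (d + d) :=
  \prod_(l <- w) ncX F (code l).

(** Both [x_i y_i = 1] and [y_i x_i = 1] occur, since the letter [l] runs over both signs. *)
Definition group_rel (k : 'I_(d + d + r)) : ncalg F (d + d) :=
  match split k with
  | inl l => ncX F l * ncX F (code (flip (decode l))) - 1
  | inr j => ncword (P j) - 1
  end.

Lemma group_rel_cancel l :
  group_rel (lshift r (code l)) = ncX F (code l) * ncX F (code (flip l)) - 1.
Proof.
by rewrite /group_rel -[lshift _ _]/(unsplit (inl _)) unsplitK codeK.
Qed.

Lemma group_rel_word j : group_rel (rshift (d + d) j) = ncword (P j) - 1.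
Proof. by rewrite /group_rel -[rshift _ _]/(unsplit (inr _)) unsplitK. Qed.

Lemma group_relP (Pr : ncalg F (d + d) -> Prop) :
  (forall l, Pr (ncX F (code l) * ncX F (code (flip l)) - 1)) ->
  (forall j, Pr (ncword (P j) - 1)) -> forall k, Pr (group_rel k).
Proof.
move=> Pcancel Pword k; rewrite -[k]splitK; case: (split k) => [l|j].
  by rewrite -[l]decodeK group_rel_cancel.
by rewrite group_rel_word.
Qed.

Lemma nceval_ncword (A : algType F) (a : 'I_(d + d) -> A) w :
  nceval a (ncword w) = \prod_(l <- w) a (code l).
Proof.
rewrite (nceval_prod a); apply: eq_bigr => l _; exact: ncevalX.
Qed.

Lemma nceval_sub1 (A : algType F) (a : 'I_(d + d) -> A) p :
  nceval a (p - 1) = nceval a p - 1.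
Proof. by rewrite (ncevalB a p 1) (nceval1 a). Qed.

Lemma nceval_XX (A : algType F) (a : 'I_(d + d) -> A) k l :
  nceval a (ncX F k * ncX F l) = a k * a l.
Proof. by rewrite (ncevalM a (ncX F k)) (ncevalX a k) (ncevalX a l). Qed.

Lemma ncmonom_ncword (s : seq 'I_(d + d)) :
  mkmalgU (FMonom s) 1 = ncword (map (@decode d) s).
Proof.
by rewrite ncmonomE /ncword big_map; apply: eq_bigr => k _; rewrite decodeK.
Qed.

(** Induction on the derivation: cancellations and relators are generators of the ideal, and
    concatenation is handled by [ideal_subM]. *)
Lemma gword_cong_ideal u v : gword_cong P u v ->
  in_two_sided_ideal group_rel (ncword u - ncword v).
Proof.
elim=> {u v} [u|u v _ IH|u v w _ IH1 _ IH2|u u' v v' _ IH1 _ IH2|i b|j].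
- by rewrite subrr; apply: ideal0.
- by rewrite -opprB; apply: idealN.
- by rewrite -(subrKA (ncword v)); apply: idealD.
- by rewrite /ncword !big_cat; apply: ideal_subM.
- have := ideal_gen group_rel (lshift r (code (i, b))).
  by rewrite group_rel_cancel /ncword big_cons big_seq1 big_nil.
- have := ideal_gen group_rel (rshift (d + d) j).
  by rewrite group_rel_word [ncword [::]]big_nil.
Qed.

End StandardPresentation.

Section GroupAlgebraPresentation.
Variables (F : fieldType) (G : groupType) (d r : nat).
Variables (P : 'I_r -> gword d) (g : 'I_d -> G).

Definition galgU (y : G) : group_algebra F G := mkmalgU y 1.

Lemma galgU1 : galgU 1%g = 1. Proof. by []. Qed.

Lemma galgUM y z : galgU (y * z)%g = galgU y * galgU z.
Proof. by rewrite [RHS]galg_mulUU mulr1. Qed.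

Definition galg_gen (k : 'I_(d + d)) : group_algebra F G :=
  galgU (gword_eval g [:: decode k]).

Lemma gword_eval_cat u v :
  gword_eval g (u ++ v) = (gword_eval g u * gword_eval g v)%g.
Proof. by rewrite /gword_eval big_cat. Qed.

Lemma nceval_galg_gen w :
  nceval galg_gen (ncword F w) = galgU (gword_eval g w).
Proof.
rewrite nceval_ncword; elim: w => [|l w IHw].
  by rewrite /gword_eval !big_nil galgU1.
by rewrite big_cons IHw -cat1s gword_eval_cat galgUM /galg_gen codeK.
Qed.

Hypothesis hG : presents_group P g.

Let word_ex (y : G) : exists w, gword_eval g w == y.
Proof. by have [w <-] := hG.1 y; exists w. Qed.

Definition group_word (y : G) : gword d := xchoose (word_ex y).

Lemma group_wordK y : gword_eval g (group_word y) = y.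
Proof. exact/eqP/(xchooseP (word_ex y)). Qed.

(** A linear section of evaluation at [galg_gen], sending each group element to a chosen word. *)
Definition galg_lift (z : group_algebra F G) : ncalg F (d + d) :=
  mmap (in_alg (ncalg F (d + d))) (fun y => ncword F (group_word y)) z.

Lemma galg_liftU c y :
  galg_lift (mkmalgU y c) = c *: ncword F (group_word y).
Proof. by rewrite /galg_lift mmapU mulr_algl. Qed.

Lemma galg_liftK z : nceval galg_gen (galg_lift z) = z.
Proof.
rewrite /galg_lift /mmap (nceval_sum galg_gen) [RHS]monalgE.
apply: eq_bigr => y _; rewrite (ncevalM galg_gen) (ncevalC galg_gen).
rewrite nceval_galg_gen group_wordK mulr_algl.
by rewrite [LHS]galgZU mulr1.
Qed.

(** A monomial and the word chosen for its value represent the same group element, hence are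
    congruent; linearity does the rest. On the kernel of evaluation the lift is zero. *)
Lemma galg_lift_ideal p :
  in_two_sided_ideal (group_rel F P) (p - galg_lift (nceval galg_gen p)).
Proof.
pose f m : ncalg F (d + d) := mkmalgU m p@_m.
have defp : p = \sum_(m <- msupp p) f m by exact: ncalgE.
have -> : p - galg_lift (nceval galg_gen p) =
    \sum_(m <- msupp p) (f m - galg_lift (nceval galg_gen (f m))).
  rewrite big_split /= -defp sumrN; congr (_ - _).
  by rewrite {1}defp (nceval_sum galg_gen) /galg_lift raddf_sum.
apply: ideal_sum => -[s].
have -> : f (FMonom s) = p@_(FMonom s) *: ncword F (map (@decode d) s).
  by rewrite -ncmonom_ncword ncscaleU mulr1.
rewrite (ncevalZ galg_gen) nceval_galg_gen [_ *: galgU _]galgZU galg_liftU.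
rewrite mulr1 -scalerBr; apply: idealZ; apply: gword_cong_ideal.
by apply/hG.2; rewrite group_wordK.
Qed.

Lemma presents_group_algebra : presents_algebra (group_rel F P) galg_gen.
Proof.
split=> [z|p]; first by exists (galg_lift z); exact: galg_liftK.
split=> [p0|]; last first.
  apply: nceval_ideal.
  apply: (group_relP (Pr := fun q => nceval galg_gen q = 0)) => [[i b]|j].
    have -> : ncX F (code (i, b)) * ncX F (code (flip (i, b))) =
        ncword F [:: (i, b); (i, ~~ b)].
      by rewrite /ncword big_cons big_seq1.
    rewrite nceval_sub1 nceval_galg_gen.
    have /hG.2 -> := GCcancel P i b.
    by rewrite [gword_eval g [::]]big_nil galgU1 subrr.
  rewrite nceval_sub1 nceval_galg_gen.
  have /hG.2 -> := GCrel P j.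
  by rewrite [gword_eval g [::]]big_nil galgU1 subrr.
have := galg_lift_ideal p; rewrite p0.
by rewrite /galg_lift raddf0 subr0.
Qed.
End GroupAlgebraPresentation.

(** * Nearby invertible matrices and stability of inversion *)

Section NearInverse.
Variable F : fieldType.

(** In the factorization of [A] through [pid_mx (\rank A)], the middle factor is replaced by the
    identity. *)
Lemma unitmx_near n (A : 'M[F]_n) :
  exists2 C, C \in unitmx & (\rank (A - C)%R <= n - \rank A)%N.
Proof.
exists (col_ebase A *m row_ebase A).
  by rewrite unitmx_mul col_ebase_unit row_ebase_unit.
have -> : A - col_ebase A *m row_ebase A =
    col_ebase A *m (pid_mx (\rank A) - 1%:M) *m row_ebase A.
  by rewrite mulmxBr mulmxBl mulmx1 mulmx_ebase.
apply: leq_trans (mxrankM_maxl _ _) _; apply: leq_trans (mxrankM_maxr _ _) _.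
by rewrite -mxrank_opp opprB rank_copid_mx ?rank_leq_row.
Qed.

(** [A1] has rank at least [n - t], so some invertible [C] is within [t]; then [A2 - C^-1 = C^-1
    ((A1 A2 - 1) - (A1 - C) A2)]. *)
Lemma unitmx_near_pair n (A1 A2 : 'M[F]_n) t :
  (\rank (A1 *m A2 - 1%:M)%R <= t)%N ->
  exists C, [/\ C \in unitmx, (\rank (A1 - C)%R <= t + t)%N
              & (\rank (A2 - invmx C)%R <= t + t)%N].
Proof.
move=> le_t; have [C uC leC] := unitmx_near A1.
have {}leC : (\rank (A1 - C)%R <= t)%N.
  apply: leq_trans leC _; rewrite leq_subLR.
  rewrite -[X in (X <= _)%N](mxrank1 F n) -(subKr (A1 *m A2) 1%:M).
  exact: leq_trans (mxrankB _ _) (leq_add (mxrankM_maxl _ _) le_t).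
exists C; split=> //; first exact: leq_trans leC (leq_addr _ _).
have -> : A2 - invmx C = invmx C *m ((A1 *m A2 - 1%:M) - (A1 - C) *m A2).
  rewrite mulmxBl addrAC opprB addrCA subrr addr0.
  by rewrite mulmxBr mulmxA mulVmx // mul1mx mulmx1.
apply: leq_trans (mxrankM_maxr _ _) _; apply: leq_trans (mxrankB _ _) _.
exact: leq_add le_t (leq_trans (mxrankM_maxl _ _) leC).
Qed.

(** The identity [a^-1 - b^-1 = - a^-1 (a - b) b^-1] acquires two correction terms with the factor
    [en - em], as padded identities of different sizes differ. Each costs at most [\rank (a - b)],
    because [a] and [b] have ranks [n] and [m]. *)
Lemma rank_hat_sub_inv n m (A : 'M[F]_n) (B : 'M[F]_m) :
  A \in unitmx -> B \in unitmx ->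
  (rank_hat_sub (invmx A) (invmx B) <= 3 * rank_hat_sub A B)%N.
Proof.
move=> uA uB; pose N := maxn n m.
have leN : (n <= N)%N by apply: leq_maxl.
have leM : (m <= N)%N by apply: leq_maxr.
have := rank_hat_sub_scalar n m (1 : F).
rewrite !(@rank_hat_subE _ N) //.
set a := hat N A; set b := hat N B; set a' := hat N (invmx A).
set b' := hat N (invmx B); set en := hat N (1%:M : 'M_n).
set em := hat N 1%:M => le1.
have a'en : a' *m en = a' by rewrite -hatM // mulmx1.
have emb' : em *m b' = b' by rewrite -hatM // mul1mx.
have a'a : a' *m a = en by rewrite -hatM // mulVmx.
have bb' : b *m b' = em by rewrite -hatM // mulmxV.
have le_nm : (n - m + (m - n) <= \rank (a - b)%R)%N.
  have rka : \rank a = n by rewrite mxrank_hat // mxrank_unit.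
  have rkb : \rank b = m by rewrite mxrank_hat // mxrank_unit.
  have := mxrankB a (a - b); have := mxrank_add b (a - b).
  by rewrite subKr addrC subrK rka rkb; lia.
have -> : a' - b' = a' *m (en - em) - a' *m (a - b) *m b' + (en - em) *m b'.
  rewrite mulmxBr a'en mulmxBr a'a !mulmxBl emb' -(mulmxA a') bb'.
  by rewrite opprB !subrKA.
have le_e := leq_trans le1 le_nm.
rewrite mulSn mulSn mul1n addnA.
apply: leq_trans (mxrank_add _ _) _; apply: leq_add; last first.
  exact: leq_trans (mxrankM_maxl _ _) le_e.
apply: leq_trans (mxrankB _ _) _; apply: leq_add.
  exact: leq_trans (mxrankM_maxr _ _) le_e.
exact: leq_trans (mxrankM_maxl _ _) (mxrankM_maxr _ _).
Qed.

End NearInverse.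

(** * Matrices for letters and their inverses *)

Section Letters.
Variables (F : fieldType) (d n : nat) (A : 'I_d -> 'M[F]_n.+1).

Definition letter_mx (k : 'I_(d + d)) : 'M[F]_n.+1 :=
  let l := decode k in if l.2 then (A l.1)^-1 else A l.1.

Lemma letter_mx_code i b :
  letter_mx (code (i, b)) = if b then (A i)^-1 else A i.
Proof. by rewrite /letter_mx codeK. Qed.

Lemma nceval_letter_mx w : nceval letter_mx (ncword F w) = gword_mx A w.
Proof.
rewrite (nceval_ncword letter_mx); apply: eq_bigr => -[i b] _.
exact: letter_mx_code.
Qed.

Hypothesis uA : forall i, A i \in unitmx.

Lemma letter_mx_cancel l :
  letter_mx (code l) * letter_mx (code (flip l)) = 1.
Proof.
by case: l => i []; rewrite !letter_mx_code /= ?(mulVr (uA i)) ?(mulrV (uA i)).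
Qed.

End Letters.

(** * From integer rank bounds to real ones *)

Section RealBounds.
Variable R : realType.

Lemma rk_lt (F : fieldType) n (A : 'M[F]_n.+1) (c : R) :
  (rk R A < c) = ((\rank A)%:R < c * n.+1%:R).
Proof. by rewrite /rk ltr_pdivrMr ?ltr0n. Qed.

(** Positivity of [c] covers [r = 0], where the maximum is [0]. *)
Lemma bigmax_natr_lt r (f : 'I_r -> nat) (c : R) :
  0 < c -> (forall i, (f i)%:R < c) -> (\max_i f i)%N%:R < c.
Proof.
move=> c0 fc; elim/big_ind: _ => // x y xc yc.
by rewrite /maxn; case: ifP.
Qed.

(** Dividing by [a.+1] instead of [a] admits [a = 0]. *)
Lemma muln_natr_lt (a t : nat) (e c : R) :
  t%:R < e / a.+1%:R * c -> (a * t)%N%:R < e * c.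
Proof.
rewrite mulrAC ltr_pdivlMr ?ltr0n // -natrM mulnC => lt_t.
by apply: le_lt_trans lt_t; rewrite ler_nat leq_mul.
Qed.

Lemma natr_lt_half (a b x t u : nat) (e c : R) :
  (x <= a * t + b * u)%N -> t%:R < e / 2 / a.+1%:R * c ->
  u%:R < e / 2 / b.+1%:R * c -> x%:R < e * c.
Proof.
move=> lex /muln_natr_lt lta /muln_natr_lt ltb.
rewrite [e]splitr mulrDl; apply: le_lt_trans (ltrD lta ltb).
by rewrite -natrD ler_nat.
Qed.

End RealBounds.

Lemma uniform_lipschitz (F : fieldType) (d r : nat) (p : 'I_r -> ncalg F d) :
  exists C, forall k n m (A : 'I_d -> 'M[F]_n.+1) (B : 'I_d -> 'M[F]_m.+1) t,
    (forall i, rank_hat_sub (A i) (B i) <= t)%N ->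
    ((n - m) + (m - n) <= t)%N ->
    (rank_hat_sub (nceval A (p k)) (nceval B (p k)) <= C * t)%N.
Proof.
apply: uniform_bound => [k C D leCD lipC n m A B t leAB let_|k].
  exact: leq_trans (lipC _ _ _ _ _ leAB let_) (leq_mul _ _).
exact: nceval_lipschitz.
Qed.

Lemma uniform_rank_ideal (F : fieldType) (d r s : nat)
    (P : 'I_r -> ncalg F d) (p : 'I_s -> ncalg F d) :
  (forall k, in_two_sided_ideal P (p k)) ->
  exists C, forall k n (A : 'I_d -> 'M[F]_n.+1) t,
    (forall i, \rank (nceval A (P i)) <= t)%N ->
    (\rank (nceval A (p k)) <= C * t)%N.
Proof.
move=> idp; apply: uniform_bound => [k C D leCD bdC n A t leP|k].
  exact: leq_trans (bdC _ _ _ leP) (leq_mul _ _).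
exact: rank_nceval_ideal.
Qed.

(** * The two implications *)

Section Main.
Variables (R : realType) (F : fieldType) (G : groupType) (d r : nat).
Variables (P : 'I_r -> gword d) (g : 'I_d -> G).

Lemma stable_group_algebra :
  presents_group P g ->
  rank_stable_group R F P -> rank_stable_algebra R (group_algebra F G).
Proof.
move=> hG stabP; exists (d + d)%N, (d + d + r)%N, (group_rel F P).
exists (galg_gen F g); split; first exact: presents_group_algebra.
have [L lipL] := uniform_lipschitz (group_rel F P).
move=> eps eps_gt0.
(* [4] is the successor of [3], the factor lost by inversion. *)
have [|delta delta_gt0 stab] := stabP (eps / 2 / 4%:R).
  by rewrite !divr_gt0 ?ltr0n.
(* The first bound makes [C] an admissible input for [stab]; the second keeps the distance [2 * t]
   from [A] to [C] within half of [eps]. *)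
pose delta0 := Num.min (delta / (1 + L * 2).+1%:R) (eps / 2 / 3%:R).
exists delta0 => [|n A smallA].
  by rewrite lt_min !divr_gt0 ?ltr0n.
have n_gt0 : 0 < n.+1%:R :> R by rewrite ltr0n.
pose t := (\max_k \rank (nceval A (group_rel F P k)))%N.
have le_t k : (\rank (nceval A (group_rel F P k)) <= t)%N.
  exact: (leq_bigmax k).
have {smallA} lt_t : t%:R < delta0 * n.+1%:R.
  apply: bigmax_natr_lt => [|k]; last by rewrite -rk_lt.
  by rewrite mulr_gt0 // lt_min !divr_gt0 ?ltr0n.
have lt_t1 : t%:R < delta / (1 + L * 2).+1%:R * n.+1%:R.
  by apply: lt_le_trans lt_t _; rewrite ler_pM2r // ge_min lexx.
have lt_t2 : t%:R < eps / 2 / 3%:R * n.+1%:R.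
  by apply: lt_le_trans lt_t _; rewrite ler_pM2r // ge_min lexx orbT.
have /fin_all_exists[C closeC] i : exists C, [/\ C \in unitmx,
    (\rank (A (code (i, false)) - C)%R <= t + t)%N
  & (\rank (A (code (i, true)) - invmx C)%R <= t + t)%N].
  apply: unitmx_near_pair.
  have := le_t (lshift r (code (i, false))).
  by rewrite group_rel_cancel nceval_sub1 nceval_XX.
have uC i : C i \in unitmx by case: (closeC i).
have AC k : (rank_hat_sub (A k) (letter_mx C k) <= 2 * t)%N.
  rewrite -[k]decodeK rank_hat_sub_same mul2n -addnn; case: (decode k) => i b.
  by rewrite letter_mx_code; case: (closeC i) b => _ ? ? [].
(* Passing from [A] to [letter_mx C], at distance at most [2 * t], changes a relation by rank at
   most [L * (2 * t)]. *)
have relC j : (\rank (gword_mx C (P j) - 1%:M)%R <= (1 + L * 2) * t)%N.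
  have := lipL (rshift (d + d) j) n n A (letter_mx C) (2 * t)%N AC.
  rewrite subnn => /(_ isT); rewrite rank_hat_sub_same => leL.
  have -> : gword_mx C (P j) - 1%:M =
      nceval (letter_mx C) (group_rel F P (rshift (d + d) j)).
    by rewrite group_rel_word nceval_sub1 nceval_letter_mx.
  rewrite -[X in \rank X](subKr (nceval A (group_rel F P (rshift (d + d) j)))).
  rewrite mulnDl mul1n -mulnA.
  exact: leq_trans (mxrankB _ _) (leq_add (le_t _) leL).
have [|m [B [uB CB relB]]] := stab n C uC.
  move=> j; rewrite rk_lt; apply: le_lt_trans (muln_natr_lt lt_t1).
  by rewrite ler_nat.
exists m, (letter_mx B); split.
  apply: (group_relP (Pr := fun q => nceval (letter_mx B) q = 0)) => [l|j].
    by rewrite nceval_sub1 nceval_XX letter_mx_cancel // subrr.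
  by rewrite nceval_sub1 nceval_letter_mx relB subrr.
pose u := (\max_i rank_hat_sub (C i) (B i))%N.
have lt_u : u%:R < eps / 2 / 4%:R * n.+1%:R.
  by apply: bigmax_natr_lt => //; rewrite !mulr_gt0 ?invr_gt0 ?ltr0n.
move=> k; apply: (natr_lt_half (a := 2) (b := 3) _ lt_t2 lt_u).
apply: leq_trans (rank_hat_sub_trans (letter_mx C k) _ _) (leq_add (AC k) _).
rewrite -[k]decodeK; case: (decode k) => i b; rewrite !letter_mx_code.
have le_u : (rank_hat_sub (C i) (B i) <= u)%N by exact: (leq_bigmax i).
case: b; last by rewrite (leq_trans le_u) // leq_pmull.
apply: leq_trans (rank_hat_sub_inv (uC i) (uB i)) _.
by rewrite leq_mul2l.
Qed.

Lemma stable_algebra_group :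
  presents_group P g ->
  rank_stable_algebra R (group_algebra F G) -> rank_stable_group R F P.
Proof.
move=> hG [d' [r' [P' [a' [[surj' ker'] stab']]]]].
pose a := galg_gen F g.
have [surj ker] : presents_algebra (group_rel F P) a.
  exact: presents_group_algebra.
have /fin_all_exists[q qE] k : exists q, nceval a q = a' k by exact: surj.
have /fin_all_exists[p pE] k : exists p, nceval a' p = a k by exact: surj'.
have P'0 l : nceval a' (P' l) = 0 by apply/ker'; exact: ideal_gen.
have rel0 k : nceval a (group_rel F P k) = 0 by apply/ker; exact: ideal_gen.
(* Substituting [q] turns a relation of the stable presentation into an element of the group ideal,
   since its value at [a] is the value of [P' l] at [a']. *)
pose Pq l : ncalg F (d + d) := nceval (q : 'I_d' -> ncalg F (d + d)) (P' l).
have idPq l : in_two_sided_ideal (group_rel F P) (Pq l).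
  apply/ker; rewrite /Pq (nceval_comp a q) -(P'0 l).
  exact: eq_nceval.
(* Substituting [q] into [p] returns each generator modulo the group relations; this puts [p(q(A))]
   near [A]. *)
pose pq k : ncalg F (d + d) :=
  nceval (q : 'I_d' -> ncalg F (d + d)) (p k) - ncX F k.
have idpq k : in_two_sided_ideal (group_rel F P) (pq k).
  apply/ker; rewrite /pq (ncevalB a) (nceval_comp a q) (ncevalX a) -(pE k).
  by apply/eqP; rewrite subr_eq0; apply/eqP; exact: eq_nceval.
have [C1 rankPq] := uniform_rank_ideal idPq.
have [C2 rankpq] := uniform_rank_ideal idpq.
have [C3 lipp] := uniform_lipschitz (p : 'I_(d + d) -> ncalg F d').
have [K adjust] := size_adjust (P' : 'I_r' -> ncalg F d').
(* Coefficients of [t] and [u] in the total error [C2 * t + C3 * (K.+1 * (C1 * t + u))]. *)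
pose M1 := (C2 + C3 * (K.+1 * C1))%N; pose M2 := (C3 * K.+1)%N.
move=> eps eps_gt0.
have [|delta' delta'_gt0 stab] := stab' (eps / 2 / M2.+1%:R).
  by rewrite !divr_gt0 ?ltr0n.
pose delta0 := Num.min (delta' / C1.+1%:R) (eps / 2 / M1.+1%:R).
exists delta0 => [|n A uA smallA].
  by rewrite lt_min !divr_gt0 ?ltr0n.
have n_gt0 : 0 < n.+1%:R :> R by rewrite ltr0n.
pose Al := letter_mx A.
pose t := (\max_j \rank (gword_mx A (P j) - 1%:M)%R)%N.
have {smallA} lt_t : t%:R < delta0 * n.+1%:R.
  apply: bigmax_natr_lt => [|k]; last by rewrite -rk_lt.
  by rewrite mulr_gt0 // lt_min !divr_gt0 ?ltr0n.
have lt_t1 : t%:R < delta' / C1.+1%:R * n.+1%:R.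
  by apply: lt_le_trans lt_t _; rewrite ler_pM2r // ge_min lexx.
have lt_t2 : t%:R < eps / 2 / M1.+1%:R * n.+1%:R.
  by apply: lt_le_trans lt_t _; rewrite ler_pM2r // ge_min lexx orbT.
have le_t k : (\rank (nceval Al (group_rel F P k)) <= t)%N.
  move: k; apply: (group_relP (Pr := fun q => (\rank (nceval Al q) <= t)%N)).
    move=> l; rewrite nceval_sub1 nceval_XX.
    by rewrite letter_mx_cancel // subrr mxrank0.
  move=> j; rewrite nceval_sub1 nceval_letter_mx.
  exact: (leq_bigmax j).
pose A' k := nceval Al (q k).
have rankA' l : (\rank (nceval A' (P' l)) <= C1 * t)%N.
  by rewrite -(nceval_comp Al q); exact: rankPq.
have [|m0 [B0 [relB0 AB0]]] := stab n A'.
  move=> l; rewrite rk_lt; apply: le_lt_trans (muln_natr_lt lt_t1).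
  by rewrite ler_nat.
pose u := (\max_i rank_hat_sub (A' i) (B0 i))%N.
have lt_u : u%:R < eps / 2 / M2.+1%:R * n.+1%:R.
  by apply: bigmax_natr_lt => //; rewrite !mulr_gt0 ?invr_gt0 ?ltr0n.
have le_u k : (rank_hat_sub (A' k) (B0 k) <= u)%N by exact: (leq_bigmax k).
(* [C1 * t + u] bounds both the defect of [A'] and its distance to [B0]. *)
have [||m [B' [relB' AB' size_m]]] := adjust n m0 A' B0 (C1 * t + u)%N _ relB0.
- by move=> l; apply: leq_trans (rankA' l) (leq_addr _ _).
- by move=> k; apply: leq_trans (le_u k) (leq_addl _ _).
pose Bl k := nceval B' (p k).
(* Substituting [p] into a group relation gives an element of the ideal of [P'], which vanishes at
   [B']. *)
have relBl k : nceval Bl (group_rel F P k) = 0.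
  rewrite -(nceval_comp B' p); apply: nceval_ideal relB' _; apply/ker'.
  rewrite (nceval_comp a' p) -[RHS](rel0 k); exact: eq_nceval.
pose B i := Bl (code (i, false)).
have Bl_cancel l : Bl (code l) * Bl (code (flip l)) = 1.
  apply/eqP; rewrite -subr_eq0 -(relBl (lshift r (code l))).
  by rewrite group_rel_cancel nceval_sub1 nceval_XX.
have uB i : B i \in unitmx.
  by have [] := mulmx1_unit (Bl_cancel (i, false)).
(* The cancellation relations force each inverse letter to take the value [(B i)^-1]. *)
have BlE k : Bl k = letter_mx B k.
  rewrite -[k]decodeK; case: (decode k) => i [] //; rewrite letter_mx_code //.
  by rewrite -[LHS](mulKr (uB i)) (Bl_cancel (i, false)) mulr1.
exists m, B; split=> // [i|j].
  apply: (natr_lt_half (a := M1) (b := M2) _ lt_t2 lt_u).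
  have -> : A i = Al (code (i, false)) by rewrite /Al letter_mx_code.
  rewrite /B; move: (code (i, false)) => k.
  apply: leq_trans (rank_hat_sub_trans (nceval A' (p k)) _ _) _.
  have le1 : (rank_hat_sub (Al k) (nceval A' (p k)) <= C2 * t)%N.
    rewrite rank_hat_subC rank_hat_sub_same -(nceval_comp Al q).
    have := rankpq k n Al t le_t.
    by rewrite /pq (ncevalB Al) (ncevalX Al).
  (* [K.+1] dominates both the factor [1] of the distance and the factor [K] of the size
     difference. *)
  have le2 : (rank_hat_sub (nceval A' (p k)) (Bl k) <=
              C3 * (K.+1 * (C1 * t + u)))%N.
    apply: lipp => [i'|].
      by apply: leq_trans (AB' i') _; rewrite leq_pmull.
    by apply: leq_trans size_m _; rewrite leq_mul2r leqnSn orbT.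
  apply: leq_trans (leq_add le1 le2) _.
  by rewrite /M1 /M2; lia.
rewrite -nceval_letter_mx -(eq_nceval _ BlE); apply/eqP.
have := relBl (rshift (d + d) j); rewrite group_rel_word nceval_sub1.
by move/eqP; rewrite subr_eq0.
Qed.

End Main.

Theorem theorem6p3 (R : realType) (F : fieldType) (G : groupType)
    (d r : nat) (P : 'I_r -> gword d) (g : 'I_d -> G)
    (hG : presents_group P g) :
  rank_stable_group R F P <-> rank_stable_algebra R (group_algebra F G).
Proof.
by split; [exact: stable_group_algebra hG | exact: stable_algebra_group hG].
Qed.
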